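(* Let $x_0,\dots,x_m\in\mathbb{C}^n$, let $X=[x_0\ \cdots\ x_{m-1}]$, $Y=[x_1\ \cdots\ x_m]\in\mathbb{C}^{n\times m}$, let $A=YX^+\in\mathbb{C}^{n\times n}$ be the system matrix to the data, and let $w\in\mathbb{C}^n$ be arbitrary. Then the following statements are equivalent: (i) $\ker(X)\subseteq\ker(w^*Y)$, i.e., $Xz=0$ implies $w^*Yz=0$ for all $z\in\mathbb{C}^m$. (ii) The system matrix is exact on $w$, i.e., $w^*AX=w^*Y$.
   Context: $X^+$ denotes the Moore-Penrose pseudoinverse of $X$ and $w^*$ the conjugate transpose of $w$. For data $x_0,\dots,x_m\in\mathbb{C}^n$ with $X=[x_0\ \cdots\ x_{m-1}]$ and $Y=[x_1\ \cdots\ x_m]$, the matrix $A=YX^+$ is called the system matrix to the data. *)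

(* Defs.v *)
From mathcomp Require Import all_boot all_order all_algebra.
From mathcomp Require Import boolp classical_sets.
From mathcomp Require Import reals.
From mathcomp Require Import complex.

Set Implicit Arguments.
Unset Strict Implicit.
Unset Printing Implicit Defensive.

Import Order.TTheory GRing.Theory Num.Theory.
Local Open Scope ring_scope.
Local Open Scope complex_scope.
Local Open Scope sesquilinear_scope.

(* [M ^t*] is the conjugate transpose from [spectral]. *)

(* The four Penrose equations. Note that MathComp's [pinvmx] is only a partial
   inverse on the row space and does not satisfy the last two in general. *)
Definition is_moore_penrose (C : numClosedFieldType) (n m : nat)
    (X : 'M[C]_(n, m)) (P : 'M[C]_(m, n)) : Prop :=
  [/\ X *m P *m X = X,
      P *m X *m P = P,
      (X *m P)^t* = X *m P &
      (P *m X)^t* = P *m X].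

Section Existence.
Variable C : numClosedFieldType.

Lemma adjmxM m n p (A : 'M[C]_(m, n)) (B : 'M_(n, p)) :
  (A *m B)^t* = B^t* *m A^t*.
Proof. by rewrite trmx_mul map_mxM. Qed.

Lemma mulmx_adj_eq0 m n (A : 'M[C]_(m, n)) : A *m A^t* = 0 -> A = 0.
Proof.
move=> AA0; apply/matrixP=> i j; rewrite mxE.
have /eqP := congr1 (fun M : 'M[C]_m => M i i) AA0.
rewrite /= !mxE psumr_eq0; last by move=> k _; rewrite !mxE mul_conjC_ge0.
by move=> /allP /(_ j (mem_index_enum _)); rewrite !mxE mul_conjC_eq0 => /eqP.
Qed.

Lemma gram_unitmx r n (A : 'M[C]_(r, n)) :
  row_free A -> A *m A^t* \in unitmx.
Proof.
move=> freeA; rewrite -row_free_unit -kermx_eq0.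
apply/eqP; set K := kermx _.
have K0 : K *m (A *m A^t*) = 0 by exact: mulmx_ker.
have KA0 : K *m A = 0.
  by apply: mulmx_adj_eq0; rewrite adjmxM mulmxA -(mulmxA K) K0 mul0mx.
by apply: (row_free_inj freeA); rewrite KA0 mul0mx.
Qed.

Lemma moore_penrose_exists n m (X : 'M[C]_(n, m)) :
  exists P, is_moore_penrose X P.
Proof.
rewrite -(mulmx_base X).
move: (col_base X) (row_base X) (col_base_full X) (row_base_free X).
move: (\rank X) => r F G fullF freeG.
have GU : G *m G^t* \in unitmx := gram_unitmx freeG.
have FU : F^t* *m F \in unitmx.
  rewrite -{2}[F]trmxCK; apply: gram_unitmx.
  by rewrite row_free_map /row_free mxrank_tr.
have GG : (G *m G^t*)^t* = G *m G^t* by rewrite adjmxM trmxCK.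
have FF : (F^t* *m F)^t* = F^t* *m F by rewrite adjmxM trmxCK.
pose Gi := G^t* *m invmx (G *m G^t*).
pose Fi := invmx (F^t* *m F) *m F^t*.
have GGi : G *m Gi = 1%:M by rewrite mulmxA mulmxV.
have FiF : Fi *m F = 1%:M by rewrite -mulmxA mulVmx.
have FGP : F *m G *m (Gi *m Fi) = F *m Fi.
  by rewrite -mulmxA (mulmxA G) GGi mul1mx.
have PFG : Gi *m Fi *m (F *m G) = Gi *m G.
  by rewrite -mulmxA (mulmxA Fi) FiF mul1mx.
exists (Gi *m Fi); split.
- by rewrite FGP -mulmxA (mulmxA Fi) FiF mul1mx.
- by rewrite PFG -mulmxA (mulmxA G) GGi mul1mx.
- by rewrite FGP /Fi !adjmxM trmxCK trmx_inv map_invmx FF mulmxA.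
- by rewrite PFG /Gi !adjmxM trmxCK trmx_inv map_invmx GG mulmxA.
Qed.

Lemma moore_penrose_unique n m (X : 'M[C]_(n, m)) (P Q : 'M[C]_(m, n)) :
  is_moore_penrose X P -> is_moore_penrose X Q -> P = Q.
Proof.
move=> [XPX PXP XP PX] [XQX QXQ XQ QX].
have XPQ : X *m P = X *m Q.
  by rewrite -XP -{1}XQX -mulmxA adjmxM XP XQ mulmxA XPX.
have PQX : P *m X = Q *m X.
  by rewrite -PX -{1}XQX -(mulmxA X) mulmxA adjmxM PX QX -mulmxA (mulmxA X) XPX.
by rewrite -PXP -mulmxA XPQ mulmxA PQX QXQ.
Qed.

End Existence.

(* The Moore-Penrose pseudoinverse [X^+]. The default 0 is never used, by
   [moore_penrose_exists]. *)
Definition mpinv (C : numClosedFieldType) (n m : nat) (X : 'M[C]_(n, m)) :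
  'M[C]_(m, n) := xget 0 [set P | is_moore_penrose X P]%classic.

Lemma mpinvP (C : numClosedFieldType) (n m : nat) (X : 'M[C]_(n, m)) :
  is_moore_penrose X (mpinv X).
Proof.
exact: (@xgetPex _ 0 [set P | is_moore_penrose X P]%classic
  (moore_penrose_exists X)).
Qed.

Section Data.
Variables (C : numClosedFieldType) (n m : nat) (x : 'I_m.+1 -> 'cV[C]_n).

(* [x_0 ... x_{m-1}] *)
Definition data_X : 'M[C]_(n, m) :=
  \matrix_(i < n, j < m) x (widen_ord (leqnSn m) j) i 0.

(* [x_1 ... x_m]; [lift ord0 j] has value [j.+1]. *)
Definition data_Y : 'M[C]_(n, m) :=
  \matrix_(i < n, j < m) x (lift ord0 j) i 0.

Definition system_matrix : 'M[C]_n := data_Y *m mpinv data_X.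

End Data.

(* Main.v *)
Require Import Defs.
From mathcomp Require Import all_boot all_order all_algebra.
From mathcomp Require Import reals complex.

(** A row vector [a] factors through [X], i.e. [a = b *m X] for some [b],
    exactly when [a] vanishes on the kernel of [X]; and any [P] with
    [X *m P *m X = X] then provides a canonical factor [b = a *m P].  Applying
    this to [a = w^* Y] and [P = X^+] gives the claim, since
    [w^* A X = (w^* Y) X^+ X].  The Penrose equation [X *m X^+ *m X = X] makes
    [X^+ *m X] a projection along the kernel of [X], so that the columns of
    [1 - X^+ *m X] lie in that kernel. *)

Set Implicit Arguments.
Unset Strict Implicit.
Unset Printing Implicit Defensive.

Import Order.TTheory GRing.Theory Num.Theory.
Local Open Scope ring_scope.
Local Open Scope complex_scope.
Local Open Scope sesquilinear_scope.

(** Since [X *m (1 - P *m X) = 0], vanishing on the kernel of [X] forces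
    [a *m (1 - P *m X) = 0]; conversely a product ending in [X] kills whatever
    [X] kills. *)
Lemma ker_sub_inner_inverseP (K : pzRingType) (n m p : nat)
    (X : 'M[K]_(n, m)) (P : 'M[K]_(m, n)) (a : 'M[K]_(p, m)) :
  X *m P *m X = X ->
  (forall z : 'cV[K]_m, X *m z = 0 -> a *m z = 0) <-> a *m P *m X = a.
Proof.
move=> XPX; split=> [kerXa | aPX z Xz0]; last by rewrite -aPX -mulmxA Xz0 mulmx0.
apply/esym/eqP; rewrite -subr_eq0 -mulmxA -{1}[a]mulmx1 -mulmxBr; apply/eqP.
apply/matrixP=> i j.
have /matrixP/(_ i 0) : a *m col j (1%:M - P *m X) = 0.
  by apply: kerXa; rewrite colE mulmxA mulmxBr mulmx1 mulmxA XPX subrr mul0mx.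
by rewrite colE mulmxA -colE !mxE.
Qed.

Theorem proposition3p2 (R : realType) (n m : nat)
    (x : 'I_m.+1 -> 'cV[R[i]]_n) (w : 'cV[R[i]]_n) :
  let X := data_X x in
  let Y := data_Y x in
  let A := system_matrix x in
  (forall z : 'cV[R[i]]_m, X *m z = 0 -> w^t* *m Y *m z = 0)
  <-> w^t* *m A *m X = w^t* *m Y.
Proof.
move=> X Y A; have [XPX _ _ _] := mpinvP X.
by rewrite /A /system_matrix mulmxA; apply: ker_sub_inner_inverseP.
Qed.
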